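(* Say a word $\sigma=\sigma_1\cdots\sigma_n$ over $\{1,\dots,k\}$ avoids $123$ if there is no index $i$ with $\sigma_i<\sigma_{i+1}<\sigma_{i+2}$, and let $F_{123}(x;k)=\sum_{n\ge0}f_{123}(n,k)x^n$, where $f_{123}(n,k)$ is the number of such words of length $n$. Define $a_{3m}=1$, $a_{3m+1}=-1$, $a_{3m+2}=0$ for all $m\ge0$. Then for all $k\ge0$, \[ F_{123}(x;k)=\frac{1}{\sum_{j=0}^{k}a_j\binom{k}{j}x^j}. \]
   Context: The empty word (length $0$) is counted once; for $k=0$ there are no words of positive length. *)

(* Defs.v *)
From HB Require Import structures.
From mathcomp Require Import all_boot all_order all_algebra.
From mathcomp Require Import boolp.

Set Implicit Arguments.
Unset Strict Implicit.
Unset Printing Implicit Defensive.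

Import Order.TTheory GRing.Theory Num.Theory.
Local Open Scope ring_scope.

(* Formal power series R[[x]]: a record rather than a bare [nat -> R], whose canonical ring structure
   is the pointwise one. *)
Record fps (R : Type) := Fps { fps_coef : nat -> R }.

HB.instance Definition _ (R : Type) := gen_eqMixin (fps R).
HB.instance Definition _ (R : Type) := gen_choiceMixin (fps R).

Lemma fpsP (R : Type) (f g : fps R) : fps_coef f =1 fps_coef g -> f = g.
Proof. by case: f g => [f] [g] /= /funext ->. Qed.

Section FpsRing.
Variable R : comUnitRingType.
Implicit Types f g h : fps R.

Definition fps_zero : fps R := Fps (fun=> 0).
Definition fps_opp f : fps R := Fps (fun n => - fps_coef f n).
Definition fps_add f g : fps R := Fps (fun n => fps_coef f n + fps_coef g n).
Definition fps_one : fps R := Fps (fun n => (n == 0%N)%:R).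
Definition fps_mul f g : fps R :=
  Fps (fun n => \sum_(i < n.+1) fps_coef f i * fps_coef g (n - i)%N).

Fact fps_addA : associative fps_add.
Proof. by move=> f g h; apply: fpsP => n /=; rewrite addrA. Qed.
Fact fps_addC : commutative fps_add.
Proof. by move=> f g; apply: fpsP => n /=; rewrite addrC. Qed.
Fact fps_add0 : left_id fps_zero fps_add.
Proof. by move=> f; apply: fpsP => n /=; rewrite add0r. Qed.
Fact fps_addN : left_inverse fps_zero fps_opp fps_add.
Proof. by move=> f; apply: fpsP => n /=; rewrite addNr. Qed.

HB.instance Definition _ :=
  GRing.isZmodule.Build (fps R) fps_addA fps_addC fps_add0 fps_addN.

Let trunc m f : {poly R} := \poly_(i < m) fps_coef f i.

Let coef_trunc m f i : (i < m)%N -> (trunc m f)`_i = fps_coef f i.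
Proof. by rewrite coef_poly => ->. Qed.

Let coef_trunc_mul m f g i : (i < m)%N ->
  (trunc m f * trunc m g)`_i = fps_coef (fps_mul f g) i.
Proof.
move=> im; rewrite coefM; apply: eq_bigr => j _; rewrite !coef_trunc //.
  exact: leq_ltn_trans (leq_subr _ _) im.
by apply: leq_ltn_trans im; rewrite -ltnS.
Qed.

Fact fps_mulC : commutative fps_mul.
Proof.
move=> f g; apply: fpsP => n.
by rewrite -!(@coef_trunc_mul n.+1) // mulrC.
Qed.

Fact fps_mulA : associative fps_mul.
Proof.
move=> f g h; apply: fpsP => n.
transitivity ((trunc n.+1 f * trunc n.+1 g * trunc n.+1 h)`_n).
  rewrite -mulrA coefM; apply: eq_bigr => i _.
  by rewrite coef_trunc // coef_trunc_mul // ltnS leq_subr.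
rewrite coefM; apply: eq_bigr => i _.
by rewrite coef_trunc_mul // coef_trunc // ltnS leq_subr.
Qed.

Fact fps_mul1 : left_id fps_one fps_mul.
Proof.
move=> f; apply: fpsP => n /=; rewrite big_ord_recl /= mul1r subn0.
by rewrite big1 ?addr0 // => i _; rewrite mul0r.
Qed.

Fact fps_mulD : left_distributive fps_mul fps_add.
Proof.
move=> f g h; apply: fpsP => n /=; rewrite -big_split /=.
by apply: eq_bigr => i _; rewrite mulrDl.
Qed.

Fact fps_one_neq0 : fps_one != 0.
Proof.
apply/eqP => /(congr1 (fun f => fps_coef f 0)) /= /eqP.
by rewrite oner_eq0.
Qed.

HB.instance Definition _ := GRing.Zmodule_isComNzRing.Build (fps R)
  fps_mulA fps_mulC fps_mul1 fps_mulD fps_one_neq0.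

(* [fps_inv_seq f n] lists the first [n.+1] coefficients of the inverse g of f,
   given by g_0 = f_0^-1 and
   g_(m+1) = - f_0^-1 * (f_1 g_m + ... + f_(m+1) g_0). *)
Fixpoint fps_inv_seq f (n : nat) : seq R :=
  if n is m.+1 then
    let s := fps_inv_seq f m in
    rcons s (- ((fps_coef f 0)^-1 *
                \sum_(i < m.+1) fps_coef f i.+1 * s`_(m - i)))
  else [:: (fps_coef f 0)^-1].

Definition fps_unit : pred (fps R) :=
  fun f => fps_coef f 0 \is a GRing.unit.

(* The value outside [fps_unit] is the one MathComp prescribes. *)
Definition fps_inv f : fps R :=
  if fps_unit f then Fps (fun n => (fps_inv_seq f n)`_n) else f.

Let size_inv_seq f n : size (fps_inv_seq f n) = n.+1.
Proof. by elim: n => //= n IHn; rewrite size_rcons IHn. Qed.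

Let nth_inv_seq f n i : (i <= n)%N ->
  (fps_inv_seq f n)`_i = (fps_inv_seq f i)`_i.
Proof.
elim: n => [|n IHn]; first by rewrite leqn0 => /eqP ->.
rewrite leq_eqVlt => /predU1P[-> //|]; rewrite ltnS => le_in.
by rewrite [in LHS]/= nth_rcons size_inv_seq ltnS le_in IHn.
Qed.

Fact fps_mulV : {in fps_unit, left_inverse 1 fps_inv *%R}.
Proof.
move=> f Uf; rewrite mulrC /fps_inv (Uf : fps_unit f).
rewrite unfold_in /fps_unit in Uf.
apply: fpsP => -[|n]; first by rewrite /= big_ord_recl big_ord0 addr0 divrr.
rewrite /= big_ord_recl /= subn0 nth_rcons size_inv_seq ltnn eqxx mulrN.
rewrite mulVKr //; apply/eqP; rewrite addrC subr_eq0; apply/eqP.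
apply: eq_bigr => i _; rewrite /bump /= add1n subSS.
by rewrite [in RHS]nth_inv_seq // leq_subr.
Qed.

Fact fps_unitP f g : g * f = 1 -> fps_unit f.
Proof.
move=> /(congr1 (fun h => fps_coef h 0)) /=.
rewrite big_ord_recl big_ord0 addr0 => gf1.
by apply/unitrPr; exists (fps_coef g 0); rewrite mulrC.
Qed.

Fact fps_inv_out : {in [predC fps_unit], fps_inv =1 id}.
Proof. by move=> f nUf; rewrite /fps_inv (negbTE (nUf : ~~ fps_unit f)). Qed.

HB.instance Definition _ := GRing.ComNzRing_hasMulInverse.Build (fps R)
  fps_mulV fps_unitP fps_inv_out.

Definition fps_of_poly (p : {poly R}) : fps R := Fps (fun n => p`_n).

End FpsRing.

(* The alphabet {1, ..., k} is represented by 'I_k = {0, ..., k-1}; only the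
   order of the letters matters. *)
Definition avoids123 (n k : nat) (w : n.-tuple 'I_k) : bool :=
  ~~ [exists i : 'I_n, exists j : 'I_n, exists l : 'I_n,
       [&& j == i.+1 :> nat, l == i.+2 :> nat,
           (tnth w i < tnth w j)%N & (tnth w j < tnth w l)%N]].

Definition f123 (n k : nat) : nat := #|[set w : n.-tuple 'I_k | avoids123 w]|.

Definition F123 (k : nat) : fps int := Fps (fun n => (f123 n k)%:Z).

Definition a123 (j : nat) : int :=
  match (j %% 3)%N with 0%N => 1 | 1%N => -1 | _ => 0 end.

(* The denominator of the generating function is invertible, so that the
   quotient is a genuine one. *)
Lemma den123_unit (k : nat) :
  fps_of_poly (\sum_(j < k.+1) (a123 j * ('C(k, j))%:Z) *: 'X^j)
    \is a GRing.unit.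
Proof.
rewrite unfold_in /= /fps_unit /= big_ord_recl coefD coefZ coefXn.
rewrite bin0 coef_sum big1 => [|i _]; last by rewrite coefZ coefXn mulr0.
by [].
Qed.

(* Main.v *)
Require Import Defs.
From mathcomp Require Import all_boot all_order all_algebra.
Import GRing.Theory.
Local Open Scope ring_scope.

(** Fix a word [v] of length [n > 0] and sum [a123 j] over all ways of cutting
    [v] into a strictly increasing prefix of length [j] and a remainder avoiding
    123.  If [r >= 1] is the length of the maximal strictly increasing prefix of
    [v], the admissible [j] are those among [r-2], [r-1], [r] (or none), so the
    sum vanishes: three consecutive values of [a123] add up to 0, and so do
    [a123 0 + a123 1].  There are ['C(k, j)] strictly increasing words of length
    [j], so summing over [v] shows that the coefficient of [x^n] in the product
    of the denominator with [F123 k] is 0. *)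

(** A structural recursion on lists of naturals: unlike the quantification over ordinals in
    [avoids123], it computes on cons. *)
Fixpoint no_double_rise (s : seq nat) : bool :=
  if s is x :: s' then
    (if s' is [:: y, z & _] then ~~ ((x < y) && (y < z))%N else true)
      && no_double_rise s'
  else true.

Lemma no_double_riseP (s : seq nat) :
  reflect (forall i, (i.+2 < size s)%N ->
             ~~ ((nth 0 s i < nth 0 s i.+1) && (nth 0 s i.+1 < nth 0 s i.+2))%N)
          (no_double_rise s).
Proof.
elim: s => [|x s IHs]; first by apply: ReflectT.
apply: (iffP andP) => [[hd /IHs tl] [|i]|H].
- by case: s hd {IHs tl} => [|y [|z s]].
- exact: tl.
split; first by case: s H {IHs} => [|y [|z s]] // /(_ 0%N); apply.
by apply/IHs => i; apply: (H i.+1).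
Qed.

Lemma avoids123E (n k : nat) (w : n.-tuple 'I_k) :
  avoids123 w = no_double_rise (map val w).
Proof.
have nthE (i : 'I_n) : nth 0%N (map val w) i = tnth w i.
  by rewrite (nth_map (tnth w i)) ?size_tuple // -tnth_nth.
apply/idP/no_double_riseP => [H i|H].
  rewrite size_map size_tuple => lt_i2n; apply: contra H => rise.
  have lt_i1n := ltnW lt_i2n; have lt_in := ltnW lt_i1n.
  apply/existsP; exists (Ordinal lt_in); apply/existsP; exists (Ordinal lt_i1n).
  by apply/existsP; exists (Ordinal lt_i2n); rewrite !eqxx -!nthE.
apply/negP => /existsP[i /existsP[j /existsP[l /and4P[/eqP ji /eqP li ij jl]]]].
have := H i; rewrite size_map size_tuple -li ltn_ord -ji !nthE ij jl.
by move=> /(_ isT).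
Qed.

Lemma a123_sum3 (j : nat) : a123 j + a123 j.+1 + a123 j.+2 = 0.
Proof.
rewrite /a123 -[j.+2]addn2 -[j.+1]addn1 -(modnDml j 1) -(modnDml j 2).
by have := ltn_pmod j (isT : (0 < 3)%N); case: (j %% 3)%N => [|[|[|]]].
Qed.

(** Past the end of [s], [take] and [drop] saturate, so sums over cuts stop at [j = size s]. *)
Definition cut123 (s : seq nat) (j : nat) : bool :=
  sorted ltn (take j s) && no_double_rise (drop j s).

Definition first_rise (s : seq nat) : bool :=
  if s is [:: x, y & _] then (x < y)%N else false.

(* The offset [c] is what makes the induction on the word go through. *)
Lemma sum_cut123 (c x : nat) (s : seq nat) :
  \sum_(j < (size s).+2) a123 (c + j) *+ cut123 (x :: s) j =
    if first_rise (x :: s) then 0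
    else - (a123 c.+2 *+ no_double_rise (x :: s)).
Proof.
have a2 b : - a123 b.+2 = a123 b + a123 b.+1.
  by apply/eqP; rewrite eq_sym -addr_eq0 a123_sum3.
elim: s c x => [|y s IHs] c x.
  by rewrite !big_ord_recl big_ord0 /= addn0 addn1 addr0 a2.
have cutS j : cut123 [:: x, y & s] j.+1 =
    ((x < y)%N || (j == 0%N)) && cut123 (y :: s) j.
  by case: j => [|j]; rewrite /cut123 /= ?orbT ?orbF ?andbA.
rewrite big_ord_recl addn0.
under eq_bigr => j _ do rewrite lift0 addnS -addSn cutS.
rewrite /first_rise; case: ltnP => [lt_xy|le_yx].
  (* The nonempty cuts are those of [y :: s] with offset [c.+1]; by induction they cancel the empty
     cut, or both vanish when [s] starts with some [z > y]. *)
  rewrite IHs /cut123 take0 drop0 /=.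
  (* In both branches closed by [subrr], [a123 c.+3] computes to [a123 c]. *)
  case: s {IHs cutS} => [|z s] /=; first exact: subrr.
  rewrite lt_xy; case: (ltnP y z) => _; first by rewrite mulr0n addr0.
  exact: subrr.
(* As [y <= x], only the cuts 0 and 1 survive; their remainders avoid 123 together, since no rise
   starts at [x]. *)
rewrite big_ord_recl big1 => [|j _]; last by rewrite mulr0n.
rewrite -mulNrn a2 mulrnDl /cut123 addn0 addr0 !drop0 /=.
by case: s {IHs cutS} => [|z s] //=; rewrite ltnNge le_yx.
Qed.

(** Concatenation is a bijection from pairs of tuples onto tuples of length [m + p]. *)
Lemma card_cat_tuple (T : finType) (m p : nat) (P Q : pred (seq T)) :
  #|[set v : (m + p).-tuple T | P (take m v) && Q (drop m v)]| =
  (#|[set u : m.-tuple T | P u]| * #|[set w : p.-tuple T | Q w]|)%N.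
Proof.
rewrite -cardsX.
pose f (uw : m.-tuple T * p.-tuple T) := [tuple of uw.1 ++ uw.2].
have f_inj : injective f.
  move=> [u w] [u' w'] /(congr1 val) /= /eqP.
  rewrite eqseq_cat ?size_tuple // => /andP[/eqP uu' /eqP ww'].
  by congr pair; apply: val_inj.
rewrite -(card_imset _ f_inj); apply: eq_card => v; rewrite inE.
apply/andP/imsetP => [[Pv Qv]|[[u w]]].
  have sz_take : size (take m v) == m by rewrite size_takel ?size_tuple ?leq_addr.
  have sz_drop : size (drop m v) == p by rewrite size_drop size_tuple addKn.
  exists (Tuple sz_take, Tuple sz_drop); first by rewrite !inE Pv Qv.
  by apply: val_inj; rewrite /= cat_take_drop.
rewrite !inE /= => /andP[Pu Qw] ->.
by rewrite /= take_size_cat ?drop_size_cat ?size_tuple.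
Qed.

Lemma card_cut123 (n k j : nat) : (j <= n)%N ->
  #|[set v : n.-tuple 'I_k | cut123 (map val v) j]| =
  ('C(k, j) * f123 (n - j) k)%N.
Proof.
move=> /subnKC <-; rewrite addKn -card_ltn_sorted_tuples /f123.
have -> : [set w : (n - j).-tuple 'I_k | avoids123 w] =
          [set w : (n - j).-tuple 'I_k | no_double_rise (map val w)].
  by apply/setP => w; rewrite !inE avoids123E.
rewrite -(card_cat_tuple _ _ _ (fun s : seq 'I_k => sorted ltn (map val s))
           (fun s : seq 'I_k => no_double_rise (map val s))).
by apply: eq_card => v; rewrite !inE /cut123 map_take map_drop.
Qed.

Lemma sum_a123_bin_f123 (n k : nat) :
  \sum_(j < n.+2) a123 j * ('C(k, j))%:Z * (f123 (n.+1 - j) k)%:Z = 0.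
Proof.
transitivity (\sum_(v : n.+1.-tuple 'I_k) \sum_(j < n.+2)
                a123 j *+ cut123 (map val v) j).
  rewrite exchange_big; apply: eq_bigr => j _ /=.
  rewrite -mulrA -PoszM -card_cut123 -1?ltnS // -sum1dep_card.
  rewrite -[Posz (\sum_(_ | _) _)]natz natr_sum mulr_sumr big_mkcond.
  by apply: eq_bigr => v _; case: cut123; rewrite ?mulr1.
apply: big1 => v _; case/tupleP: v => x v.
have /= := sum_cut123 0 (val x) (map val v).
rewrite size_map size_tuple => ->.
(* With offset 0, a word without initial rise leaves a multiple of [a123 2], which is 0. *)
by case: ifP => // _; rewrite /a123 mul0rn oppr0.
Qed.

Theorem theorem3p13 (k : nat) :
  F123 k =
    1 / fps_of_poly (\sum_(j < k.+1) (a123 j * ('C(k, j))%:Z) *: 'X^j).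
Proof.
apply: (mulIr (den123_unit k)); rewrite divrK ?den123_unit // mulrC.
apply: fpsP => n /=.
(* Valid for every [j]: past degree [k] the binomial coefficient vanishes. *)
have coefE j : (\sum_(i < k.+1) (a123 i * ('C(k, i))%:Z) *: 'X^i)`_j =
    a123 j * ('C(k, j))%:Z.
  rewrite -(poly_def _ (fun i => a123 i * ('C(k, i))%:Z)) coef_poly ltnS.
  by case: leqP => // /bin_small ->; rewrite mulr0.
under eq_bigr do rewrite coefE.
case: n => [|n]; last exact: sum_a123_bin_f123.
rewrite big_ord_recl big_ord0 bin0 addr0 subn0 /= !mul1r.
suff -> : f123 0 k = 1%N by [].
rewrite /f123 (_ : [set w | _] = setT) ?cardsT ?card_tuple ?expn0 //.
by apply/setP => w; rewrite !inE avoids123E (tuple0 w).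
Qed.
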